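(* Let $m,n,n_1,\ldots,n_m$ be positive integers and let $\{p_j\}_{j=1}^m\in(0,1]^m$ be rational exponents satisfying $\sum_{j=1}^m\frac{p_jn_j}{n}=1$. Let $s$ be a positive integer such that $p_js$ is an integer for all $j=1,\ldots,m$. Let $V_s$ be the vector space of all real polynomial functions $\Phi$ of the matrices $\{\pi_j\}_{j=1}^m$, $\pi_j\in\mathbb{R}^{n_j\times n}$, such that $$\Phi(\{\lambda_j\pi_j\}_{j=1}^m)=\lambda_1^{d_1}\cdots\lambda_m^{d_m}\Phi(\{\pi_j\}_{j=1}^m)\quad\text{for all }\lambda_1,\ldots,\lambda_m\in\mathbb{R},\qquad d_j:=s\,p_jn_j,$$ and $$\Phi(\{A_j\pi_jA^*\}_{j=1}^m)=\Phi(\{\pi_j\}_{j=1}^m)\quad\text{whenever }\det A_1=\cdots=\det A_m=\det A=1.$$ Then $V_s$ is spanned by polynomials of the form $\det M(\{\pi_j\}_{j=1}^m)$, where $M(\{\pi_j\}_{j=1}^m)$ is an $ns\times ns$ matrix consisting of block elements of size $n_j\times n$, $j=1,\ldots,m$, arranged in the following way: (1) Each block entry is a (real) constant multiple of $\pi_j$ for some $j=1,\ldots,m$. (2) For each $j=1,\ldots,m$, there are $p_js$ block rows of height $n_j$ (a block row being a group of $n_j$ adjacent rows of $M$). In each such block row, all block entries are multiples of $\pi_j$, and at most $n_j$ of these block entries are nonzero. (3) There are $s$ block columns of width $n$. In each block column, there are at most $n$ nonzero block entries.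
   Context: $\{\pi_j\}_{j=1}^m$ denotes the $m$-tuple $(\pi_1,\ldots,\pi_m)$. Here $A_j$ ranges over real $n_j\times n_j$ matrices, $A$ over real $n\times n$ matrices, and $A^*$ is the transpose of $A$. The coefficients multiplying $\pi_j$ in the blocks of $M$ are fixed scalars, not depending on $\{\pi_j\}_{j=1}^m$. Block rows are ordered so that those associated with $\pi_1$ come first, then those associated with $\pi_2$, and so on. *)

(* Defs.v *)
(* [R : realType] stands for the field of real numbers. *)
From mathcomp Require Import all_boot all_order all_algebra.
From mathcomp Require Import reals.
From mathcomp Require Import mpoly.

Set Implicit Arguments.
Unset Strict Implicit.
Unset Printing Implicit Defensive.

Import Order.TTheory GRing.Theory Num.Theory.
Local Open Scope ring_scope.

Definition mxtuple (R : realType) (m n : nat) (n_ : 'I_m -> nat) : Type :=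
  forall j : 'I_m, 'M[R]_(n_ j, n).

Definition entry (m n : nat) (n_ : 'I_m -> nat) : finType :=
  {j : 'I_m & ('I_(n_ j) * 'I_n)%type}.

Definition coords (R : realType) (m n : nat) (n_ : 'I_m -> nat)
    (pi : mxtuple R n n_) (i : 'I_#|entry n n_|) : R :=
  let t := enum_val i in pi (tag t) (tagged t).1 (tagged t).2.

Definition polynomial_fun (R : realType) (m n : nat) (n_ : 'I_m -> nat)
    (Phi : mxtuple R n n_ -> R) : Prop :=
  exists P : {mpoly R[#|entry n n_|]}, forall pi, Phi pi = P.@[coords pi].

(* The natural number p_j s; [Num.truncn] is exact here because p_j s is
   assumed to be a nonnegative integer (see [nblocksE]). *)
Definition nblocks (m : nat) (p : 'I_m -> rat) (s : nat) (j : 'I_m) : nat :=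
  Num.truncn (p j * s%:R).

(* d_j = s p_j n_j *)
Definition mdegree (m : nat) (n_ : 'I_m -> nat) (p : 'I_m -> rat) (s : nat)
    (j : 'I_m) : nat :=
  (nblocks p s j * n_ j)%N.

Definition in_V (R : realType) (m n : nat) (n_ : 'I_m -> nat)
    (p : 'I_m -> rat) (s : nat) (Phi : mxtuple R n n_ -> R) : Prop :=
  [/\ polynomial_fun Phi,
      forall (lam : 'I_m -> R) (pi : mxtuple R n n_),
        Phi (fun j => lam j *: pi j) =
        (\prod_(j < m) lam j ^+ mdegree n_ p s j) * Phi pi
    & forall (A_ : forall j : 'I_m, 'M[R]_(n_ j)) (A : 'M[R]_n)
             (pi : mxtuple R n n_),
        (forall j, \det (A_ j) = 1) -> \det A = 1 ->
        Phi (fun j => A_ j *m pi j *m A^T) = Phi pi].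

(* [c j k l] is the scalar in front of pi_j in the k-th of the p_j s block rows
   associated with pi_j and in the l-th of the s block columns. *)
Definition coefs (R : realType) (m : nat) (p : 'I_m -> rat) (s : nat) : Type :=
  forall j : 'I_m, 'M[R]_(nblocks p s j, s).

Definition blocks (R : realType) (m n : nat) (n_ : 'I_m -> nat)
    (p : 'I_m -> rat) (s : nat) (c : coefs R p s) (pi : mxtuple R n n_) :
    'M[R]_(\sum_(j < m) \sum_(k < nblocks p s j) n_ j, \sum_(l < s) n) :=
  \mxcol_(j < m) \mxcol_(k < nblocks p s j) \mxrow_(l < s) (c j k l *: pi j).

(* Since n and the n_j are positive, the block [c j k l *: pi_j] is nonzero as
   a function of pi exactly when the scalar [c j k l] is nonzero. *)
Definition sparse (R : realType) (m n : nat) (n_ : 'I_m -> nat)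
    (p : 'I_m -> rat) (s : nat) (c : coefs R p s) : Prop :=
  (forall (j : 'I_m) (k : 'I_(nblocks p s j)),
     (#|[set l : 'I_s | (c j k l != 0)%R]| <= n_ j)%N) /\
  (forall l : 'I_s,
     (#|[set r : {j : 'I_m & 'I_(nblocks p s j)}
          | (c (tag r) (tagged r) l != 0)%R]| <= n)%N).

Lemma nblocksE (m : nat) (p : 'I_m -> rat) (s : nat)
    (hp : forall j, 0 < p j <= 1)
    (hs : forall j, p j * s%:R \is a Num.int) (j : 'I_m) :
  (nblocks p s j)%:R = p j * s%:R :> rat.
Proof.
rewrite truncnK // natrEint hs mulr_ge0 ?ler0n //.
by have /andP[/ltW] := hp j.
Qed.

Lemma block_height (m n : nat) (n_ : 'I_m -> nat) (p : 'I_m -> rat) (s : nat)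
    (hn : (0 < n)%N) (hp : forall j, 0 < p j <= 1)
    (hsum : \sum_(j < m) p j * (n_ j)%:R / n%:R = 1)
    (hs : forall j, p j * s%:R \is a Num.int) :
  (\sum_(j < m) \sum_(k < nblocks p s j) n_ j)%N = (n * s)%N.
Proof.
have n0 : n%:R != 0 :> rat by rewrite pnatr_eq0 -lt0n.
apply/eqP; rewrite -(eqr_nat rat) natrM natr_sum; apply/eqP.
rewrite -[RHS]mul1r -[X in X * _]hsum mulr_suml; apply: eq_bigr => j _.
rewrite sum_nat_const card_ord natrM nblocksE //.
by rewrite mulrA divfK // mulrAC.
Qed.

Lemma block_width (n s : nat) : (\sum_(l < s) n)%N = (n * s)%N.
Proof. by rewrite sum_nat_const card_ord mulnC. Qed.

(* The equation [e] is discharged by [block_height] under the hypotheses on p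
   and s; it is only used to view the block matrix as an ns x ns matrix. *)
Definition block_det (R : realType) (m n : nat) (n_ : 'I_m -> nat)
    (p : 'I_m -> rat) (s : nat)
    (e : (\sum_(j < m) \sum_(k < nblocks p s j) n_ j)%N = (n * s)%N)
    (D : mxtuple R n n_ -> R) : Prop :=
  exists2 c : coefs R p s, sparse n n_ c
    & forall pi, D pi = \det (castmx (e, block_width n s) (blocks c pi)).

Definition in_span (R : realType) (T : Type) (S : (T -> R) -> Prop)
    (Phi : T -> R) : Prop :=
  exists (N : nat) (a : 'I_N -> R) (D : 'I_N -> T -> R),
    (forall i, S (D i)) /\ (forall x, Phi x = \sum_(i < N) a i * D i x).

(* Main.v *)
(* Write [D = n s] and encode monomials of degree [D] by words [T -> I], [T = 'I_D].
   Extending invariance from determinant 1 to all matrices gives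
     Phi (A_j pi_j A^T) = (\prod_j det A_j ^ (p_j s)) * det A ^ s * Phi pi,
   an identity of polynomials in the entries of A and of the A_j.  Pairing both
   sides with the symmetrized word coefficients of det A ^ s, and then with those
   of \prod_j det A_j ^ (p_j s), replaces Cayley's Omega process: the right-hand
   side becomes a nonzero constant (a sum of squares) times Phi pi, and the
   left-hand side a combination of complete contractions of the pi_j against
   block determinants of rows and of columns.  Each such contraction, given by a
   matching [kap] of row slots with column slots, is by Ryser's formula a signed
   sum over sets S of slots of the determinants det M with
   c_(j,k,l) = #{t in S | t in block row (j,k), kap t in block column l},
   and these coefficients are automatically sparse. *)
Require Import Defs.
From mathcomp Require Import all_boot all_order all_fingroup all_algebra.
From mathcomp Require Import reals mpoly polyrcf.

Set Implicit Arguments.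
Unset Strict Implicit.
Unset Printing Implicit Defensive.

Import Order.TTheory GRing.Theory Num.Theory.
Local Open Scope ring_scope.


(** * Permanents and Ryser's formula *)

Lemma surj_injectiveb (T : finType) (f : {ffun T -> T}) :
  [forall u, u \in codom f] = injectiveb f.
Proof.
apply/forallP/injectiveP => [sf|fi u]; last exact: injF_onto.
have /leq_size_uniq U := enum_uniq T.
apply/injectiveP; rewrite /injectiveb /dinjectiveb; apply: U.
  by move=> u _; apply: sf.
by rewrite size_map.
Qed.

Lemma sum_surj_perm (R : nmodType) (T : finType) (g : {ffun T -> T} -> R) :
  \sum_(f : {ffun T -> T} | [forall u, u \in codom f]) g f =
  \sum_(sg : {perm T}) g (pval sg).
Proof.
rewrite (reindex (@pval _)) /=; last first.
  exists (insubd (1%g : {perm T})) => /= f; rewrite inE surj_injectiveb => sf.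
    by apply: val_inj; apply: insubdK.
  exact: insubdK.
by apply: eq_bigl => sg; rewrite surj_injectiveb; apply: (valP sg).
Qed.

(* Ryser's formula for the permanent. *)
Lemma ryser (R : comNzRingType) (T : finType) (K : T -> T -> R) :
  \sum_(S : {set T}) (-1) ^+ #|~: S| * \prod_t \sum_(u in S) K t u =
  \sum_(sg : {perm T}) \prod_t K t (sg t).
Proof.
(* The sign is spread over the points [u] so that one product also tests [f] against [S]: if [f]
   maps into [S], each [u] outside [S] contributes -1; otherwise some value [f t] outside [S]
   contributes 0. *)
transitivity (\sum_(f : {ffun T -> T}) (\prod_t K t (f t)) *
    \sum_(S : {set T}) \prod_u (if u \in S then 1 else - (u \notin codom f)%:R)).
  under [RHS]eq_bigr do rewrite mulr_sumr.
  rewrite [RHS]exchange_big; apply: eq_bigr => S _.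
  rewrite bigA_distr_big mulr_sumr big_mkcond; apply: eq_bigr => f _ /=.
  case: ifPn => [/ffun_onP fS|].
    rewrite mulrC; congr (_ * _); rewrite -prodr_const.
    rewrite [RHS](bigID (mem S)) /= [X in _ = X * _]big1 ?mul1r; last by move=> u ->.
    rewrite (eq_bigl (fun u => u \notin S)); last by move=> u; rewrite inE.
    apply: eq_bigr => u uS; rewrite (negPf uS).
    case: (boolP (u \in codom f)) => // /codomP[t ut].
    by rewrite ut fS in uS.
  move/ffun_onP => nf.
  have [t ftS] : exists t, f t \notin S.
    by apply/existsP; rewrite -negb_forall; apply/negP => /forallP; apply: nf.
  by rewrite [X in _ = _ * X](bigD1 (f t)) //= (negPf ftS) codom_f oppr0 mul0r mulr0.
(* The sum over [S] factors into a product over [u] of 1 minus the indicator that [f] misses [u], so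
   only surjective [f] survive. *)
transitivity (\sum_(f : {ffun T -> T} | [forall u, u \in codom f])
    \prod_t K t (f t)).
  rewrite [RHS]big_mkcond; apply: eq_bigr => f _ /=.
  rewrite -(bigA_distr _ _ (fun _ => 1) (fun u => - (u \notin codom f)%:R)) /=.
  case: ifPn => [/forallP sf|].
    by rewrite [X in _ * X]big1 ?mulr1 // => u _; rewrite sf oppr0 addr0.
  rewrite negb_forall => /existsP[u nu].
  by rewrite [X in _ * X](bigD1 u) //= nu subrr mul0r mulr0.
by rewrite sum_surj_perm; apply: eq_bigr => sg _; apply: eq_bigr => t _; rewrite pvalE.
Qed.

(** * Words as coefficients of homogeneous forms *)

Definition wcomp (T I : finType) (w : T -> I) (sg : {perm T}) : {ffun T -> I} :=
  [ffun t => w (sg t)].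

(** Words that differ by a permutation of positions give the same monomial, so only symmetrized
    coefficients can be recovered. They are extracted by evaluating at the integer points where
    [x i] counts the [u] in [S] with [w0 u = i], and combining these values over all [S] by Ryser's
    formula. *)
Lemma word_sym (R : comNzRingType) (T I : finType) (phi psi : {ffun T -> I} -> R) :
  (forall x : I -> R, \sum_w phi w * \prod_t x (w t) =
                      \sum_w psi w * \prod_t x (w t)) ->
  forall w0 : T -> I, \sum_(sg : {perm T}) phi (wcomp w0 sg) =
                      \sum_(sg : {perm T}) psi (wcomp w0 sg).
Proof.
move=> E w0.
suff X (f : {ffun T -> I} -> R) : \sum_(sg : {perm T}) f (wcomp w0 sg) =
    \sum_(S : {set T}) (-1) ^+ #|~: S| *
      \sum_w f w * \prod_t \sum_(u in S) (w0 u == w t)%:R.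
  rewrite !X; apply: eq_bigr => S _; congr (_ * _).
  exact: (E (fun i => \sum_(u in S) (w0 u == i)%:R)).
under [RHS]eq_bigr do rewrite mulr_sumr.
rewrite exchange_big /=.
transitivity (\sum_w f w * \sum_(sg : {perm T}) \prod_t (w0 (sg t) == w t)%:R).
  under [RHS]eq_bigr do rewrite mulr_sumr.
  rewrite exchange_big /=; apply: eq_bigr => sg _.
  rewrite (bigD1 (wcomp w0 sg)) //= big1 ?mulr1; last first.
    by move=> t _; rewrite ffunE eqxx.
  rewrite big1 ?addr0 // => w wN.
  have [t wt] : exists t, w0 (sg t) != w t.
    apply/existsP; rewrite -negb_forall; apply: contra wN => /forallP Ew.
    by apply/eqP/ffunP => t; rewrite ffunE; apply/esym/eqP/Ew.
  by rewrite (bigD1 t) //= (negPf wt) mul0r mulr0.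
apply: eq_bigr => w _.
rewrite -(ryser (fun t u => (w0 u == w t)%:R)) mulr_sumr.
by apply: eq_bigr => S _; rewrite mulrCA.
Qed.

Lemma wcompM (T I : finType) (w : T -> I) (sg tau : {perm T}) :
  wcomp (wcomp w sg) tau = wcomp w (tau * sg)%g.
Proof. by apply/ffunP => t; rewrite !ffunE permM. Qed.

Lemma wcomp_bij (T I : finType) (sg : {perm T}) :
  bijective (fun w : {ffun T -> I} => wcomp w sg).
Proof.
by exists (fun w : {ffun T -> I} => wcomp w (sg^-1)%g) => w; rewrite wcompM ?mulVg ?mulgV;
   apply/ffunP => t; rewrite ffunE perm1.
Qed.

(** The constant is the pairing of [v] with its symmetrization [V]. Up to the factor [#|{perm T}|]
    it is the sum of the squares of [V]; if it vanished, [V] and hence the form with coefficients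
    [v] would vanish, contradicting [v0]. *)
Lemma word_pairing (R : realDomainType) (T I : finType) (v : {ffun T -> I} -> R)
    (x0 : I -> R) (v0 : \sum_w v w * \prod_t x0 (w t) != 0) :
  exists2 c : R, c != 0 & forall (phi : {ffun T -> I} -> R) (C : R),
    (forall x : I -> R, \sum_w phi w * \prod_t x (w t) =
                        C * \sum_w v w * \prod_t x (w t)) ->
    \sum_w v w * \sum_(sg : {perm T}) phi (wcomp w sg) = c * C.
Proof.
pose V (w : {ffun T -> I}) := \sum_(sg : {perm T}) v (wcomp w sg).
exists (\sum_w v w * V w); last first.
  move=> phi C E.
  have/word_sym X (x : I -> R) : \sum_w phi w * \prod_t x (w t) =
      \sum_w (C * v w) * \prod_t x (w t).
    by rewrite E mulr_sumr; apply: eq_bigr => w _; rewrite mulrA.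
  rewrite mulr_suml; apply: eq_bigr => w _; rewrite X /V -mulr_sumr.
  by rewrite -mulrA [C * _]mulrC.
have Vinv (w : {ffun T -> I}) sg : V (wcomp w sg) = V w.
  rewrite /V [RHS](reindex_inj (mulIg sg)) /=.
  by apply: eq_bigr => tau _; rewrite wcompM.
have nT0 : #|{perm T}|%:R != 0 :> R.
  by rewrite pnatr_eq0 -lt0n; apply/card_gt0P; exists 1%g.
apply: contra v0 => /eqP c0.
(* Expanding one factor [V w] and using the invariance of the other turns the sum of squares into
   [#|{perm T}|] copies of the constant. *)
have V2 : \sum_(w : {ffun T -> I}) V w ^+ 2 = 0.
  transitivity (\sum_(sg : {perm T}) \sum_(w : {ffun T -> I}) v w * V w); last first.
    by rewrite c0 big1.
  transitivity (\sum_(w : {ffun T -> I}) \sum_(sg : {perm T}) v (wcomp w sg) * V w).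
    by apply: eq_bigr => w _; rewrite expr2 {1}/V mulr_suml.
  rewrite exchange_big /=; apply: eq_bigr => sg _.
  rewrite [RHS](reindex (fun w : {ffun T -> I} => wcomp w sg)) /=; last first.
    exact/onW_bij/wcomp_bij.
  by apply: eq_bigr => w _; rewrite Vinv.
have V0 (w : {ffun T -> I}) : V w = 0.
  apply/eqP; rewrite -sqrf_eq0; apply/eqP.
  by apply: (psumr_eq0P _ V2) => // i _; apply: sqr_ge0.
suff: #|{perm T}|%:R * (\sum_(w : {ffun T -> I}) v w * \prod_t x0 (w t)) = 0.
  by move/eqP; rewrite mulf_eq0 (negPf nT0).
transitivity (\sum_(w : {ffun T -> I}) V w * \prod_t x0 (w t)); last first.
  by rewrite big1 // => w _; rewrite V0 mul0r.
under [RHS]eq_bigr do rewrite mulr_suml.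
rewrite exchange_big /= mulr_natl -sumr_const; apply: eq_bigr => sg _.
rewrite (reindex (fun w : {ffun T -> I} => wcomp w sg)) /=; last exact/onW_bij/wcomp_bij.
apply: eq_bigr => w _; congr (_ * _).
rewrite [RHS](reindex_inj (@perm_inj _ sg)) /=.
by apply: eq_bigr => t _; rewrite ffunE.
Qed.

(** * Block determinants and complete contractions *)

(** The Young subgroup of the partition of [T] into fibres of [blk]. *)
Definition blockperm (T : finType) (Y : eqType) (blk : T -> Y) : pred {perm T} :=
  fun tau => [forall t, blk (tau t) == blk t].

(** The Leibniz expansion of a block diagonal determinant, hence a product of one determinant per
    block; here [q t] is the index that slot [t] carries inside its block. *)
Definition blockdet (R : comNzRingType) (T X : finType) (Y : eqType)
    (blk : T -> Y) (q : T -> X) (x : X -> X -> R) : R :=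
  \sum_(tau | blockperm blk tau) (-1) ^+ tau * \prod_t x (q t) (q (tau t)).

(** This is [word_pairing] for words of index pairs, with [v] the Leibniz coefficients of
    [blockdet]. The point where the form does not vanish is the identity matrix: by [inj], only the
    identity permutation contributes there. *)
Lemma blockdet_pairing (R : realDomainType) (T X : finType) (Y : eqType)
    (blk : T -> Y) (q : T -> X) (inj : forall t u, blk t = blk u -> q t = q u -> t = u) :
  exists2 c : R, c != 0 &
    forall (phi : {ffun T -> X} -> {ffun T -> X} -> R) (C : R),
    (forall x : X -> X -> R, \sum_i \sum_a phi i a * \prod_t x (i t) (a t) =
                        C * blockdet blk q x) ->
    \sum_(tau | blockperm blk tau) (-1) ^+ tau *
      \sum_(sg : {perm T}) phi (wcomp q sg) (wcomp q (sg * tau)%g) = c * C.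
Proof.
pose W (tau : {perm T}) : {ffun T -> (X * X)%type} := [ffun t => (q t, q (tau t))].
pose v (w : {ffun T -> (X * X)%type}) : R := \sum_(tau | blockperm blk tau) (-1) ^+ tau * (w == W tau)%:R.
have vE (f : {ffun T -> (X * X)%type} -> R) : \sum_w v w * f w =
    \sum_(tau | blockperm blk tau) (-1) ^+ tau * f (W tau).
  under eq_bigr do rewrite mulr_suml.
  rewrite exchange_big /=; apply: eq_bigr => tau _.
  rewrite (bigD1 (W tau)) //= eqxx mulr1 big1 ?addr0 // => w /negPf->.
  by rewrite mulr0 mul0r.
have detE x : \sum_w v w * \prod_t x (w t) = blockdet blk q (fun a b => x (a, b)).
  rewrite vE; apply: eq_bigr => tau _; congr (_ * _).
  by apply: eq_bigr => t _; rewrite ffunE.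
have v0 : \sum_w v w * \prod_t (fun ab => (ab.1 == ab.2)%:R : R) (w t) != 0.
  rewrite (detE (fun ab => (ab.1 == ab.2)%:R)) /blockdet (bigD1 1%g) /=; last by apply/forallP => t; rewrite perm1.
  rewrite odd_perm1 mul1r big1; last by move=> t _; rewrite perm1 eqxx.
  rewrite big1 ?addr0 ?oner_eq0 // => tau /andP[/forallP bt tau1].
  have [t qt] : exists t, q t != q (tau t).
    apply/existsP; rewrite -negb_forall; apply: contra tau1 => /forallP Eq.
    apply/eqP/permP => t; rewrite perm1; apply: inj; first exact/eqP.
    by apply/esym/eqP.
  by rewrite (bigD1 t) //= (negPf qt) mul0r mulr0.
have [c c0 H] := @word_pairing _ _ _ v (fun ab => (ab.1 == ab.2)%:R) v0; exists c => // phi C E.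
pose fst2 (w : {ffun T -> (X * X)%type}) := [ffun t => (w t).1].
pose snd2 (w : {ffun T -> (X * X)%type}) := [ffun t => (w t).2].
rewrite -(H (fun w => phi (fst2 w) (snd2 w))).
  rewrite vE; apply: eq_bigr => tau _; congr (_ * _).
  apply: eq_bigr => sg _.
  by congr phi; apply/ffunP => t; rewrite !ffunE ?permM.
move=> x; rewrite detE -E pair_big /=.
rewrite [RHS](reindex (fun w => (fst2 w, snd2 w))) /=; last first.
  exists (fun ia : {ffun T -> X} * {ffun T -> X} => [ffun t => (ia.1 t, ia.2 t)]) => [w _|[i a] _].
    by apply/ffunP => t; rewrite !ffunE /=; case: (w t).
  by congr pair; apply/ffunP => t; rewrite !ffunE.
apply: eq_bigr => w _; congr (_ * _); apply: eq_bigr => t _.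
by rewrite !ffunE; case: (w t).
Qed.

Lemma blockpermV (T : finType) (Y : eqType) (blk : T -> Y) (tau : {perm T}) :
  blockperm blk (tau^-1)%g = blockperm blk tau.
Proof.
apply/forallP/forallP => H t; last by have := H ((tau^-1)%g t); rewrite permKV eq_sym.
by have := H (tau t); rewrite permK eq_sym.
Qed.

(* Given [f], the permutations [theta] occurring in the Leibniz formula are
   written [f * kap * rho]; the weight that Ryser's formula attaches to the
   pair (f, theta) is then the indicator of both [f] and [rho] preserving blocks. *)
Lemma contraction_det (R : comNzRingType) (D : nat) (Y1 Y2 : eqType)
    (blkR : 'I_D -> Y1) (blkC : 'I_D -> Y2) (g : 'I_D -> 'I_D -> R)
    (sg' sg : 'S_D) :
  let kap := (sg'^-1 * sg)%g in
  \sum_(tau | blockperm blkR tau) \sum_(rho | blockperm blkC rho)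
    (-1) ^+ tau * ((-1) ^+ rho * \prod_t g ((sg' * tau)%g t) ((sg * rho)%g t)) =
  (-1) ^+ kap * \sum_(S : {set 'I_D}) (-1) ^+ #|~: S| *
    \det (\matrix_(t, u) ((\sum_(t' in S)
      ((blkR t' == blkR t) && (blkC (kap t') == blkC u))%:R) * g t u)).
Proof.
move=> kap.
pose K (theta : 'S_D) t t' : R :=
  ((blkR t' == blkR t) && (blkC (kap t') == blkC (theta t)))%:R.
have KE theta (f : 'S_D) : \prod_t K theta t (f t) =
    (blockperm blkR f && blockperm blkC ((f * kap)^-1 * theta)%g)%:R.
  case: (boolP (_ && _)) => [/andP[/forallP bf /forallP bt]|].
    rewrite big1 // => t _; rewrite /K bf /=.
    by have := bt (kap (f t)); rewrite permM invMg permM !permK eq_sym => ->.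
  move=> H.
  have [t Kt] : exists t, ~~ ((blkR (f t) == blkR t) &&
      (blkC (kap (f t)) == blkC (theta t))).
    apply/existsP; rewrite -negb_forall; apply: contra H => /forallP H.
    apply/andP; split; apply/forallP => t; first by have /andP[] := H t.
    have /andP[_] := H ((f * kap)^-1 t)%g.
    by rewrite -[kap _]permM -[((f * kap)%g _)]permM mulVg perm1 permM eq_sym.
  by rewrite (bigD1 t) //= /K (negPf Kt) mul0r.
transitivity ((-1) ^+ kap * \sum_(theta : 'S_D) (-1) ^+ theta *
    ((\prod_t g t (theta t)) * \sum_(f : 'S_D) \prod_t K theta t (f t))); last first.
  congr (_ * _).
  transitivity (\sum_(theta : 'S_D) \sum_(S : {set 'I_D}) (-1) ^+ #|~: S| *
      ((-1) ^+ theta * \prod_t ((\sum_(t' in S) K theta t t') * g t (theta t)))).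
    apply: eq_bigr => theta _; rewrite -(ryser (K theta)) !mulr_sumr.
    apply: eq_bigr => S _; rewrite big_split /=.
    by rewrite [RHS]mulrCA; congr (_ * _); rewrite mulrCA; congr (_ * _); rewrite mulrC.
  rewrite exchange_big /=; apply: eq_bigr => S _; rewrite -mulr_sumr.
  congr (_ * _); apply: eq_bigr => theta _; congr (_ * _).
  by apply: eq_bigr => t _; rewrite mxE.
transitivity ((-1) ^+ kap * \sum_(f : 'S_D) \sum_(theta : 'S_D) (-1) ^+ theta *
    ((\prod_t g t (theta t)) * \prod_t K theta t (f t))); last first.
  congr (_ * _); rewrite exchange_big /=; apply: eq_bigr => theta _.
  by rewrite mulrA mulr_sumr; apply: eq_bigr => f _; rewrite mulrA.
rewrite mulr_sumr big_mkcond /= [RHS](reindex_inj invg_inj) /=.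
apply: eq_bigr => tau _; case: ifPn => btau; last first.
  rewrite big1 ?mulr0 // => theta _.
  by rewrite KE blockpermV (negPf btau) /= !mulr0.
(* After [f = tau^-1], the substitution [theta = tau^-1 * kap * rho] makes the Ryser weight the
   condition that [tau] and [rho] both preserve blocks. *)
rewrite [in RHS](reindex_inj (mulgI (tau^-1 * kap)%g)) /= big_mkcond mulr_sumr /=.
apply: eq_bigr => rho _; rewrite KE mulKg blockpermV btau /=.
case: ifPn => brho; last by rewrite !mulr0.
have sgnE : (-1) ^+ kap * (-1) ^+ (tau^-1 * kap * rho)%g =
    (-1) ^+ tau * (-1) ^+ rho :> R.
  rewrite -!signr_addb !odd_permM !odd_permV.
  by case: (odd_perm tau); case: (odd_perm sg); case: (odd_perm sg');
     case: (odd_perm rho).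
rewrite mulr1 !mulrA sgnE; congr (_ * _).
rewrite (reindex_inj (@perm_inj _ (sg' * tau)^-1)%g) /=.
apply: eq_bigr => t _; rewrite permKV; congr (g _ _).
by rewrite -[LHS]permM; congr (fun_of_perm _ _); rewrite /kap invMg !mulgA.
Qed.

(** * Polynomial identities and word expansions *)

(** A nonzero polynomial has fewer roots than its size. The threshold [k0] serves identities known
    only for large arguments, where shifted determinants are positive. *)
Lemma poly_eq0_nat (R : numDomainType) (p : {poly R}) (k0 : nat) :
  (forall k : nat, (k0 <= k)%N -> root p k%:R) -> p = 0.
Proof.
move=> rp; apply/eqP/contraT => p0.
have := max_poly_roots (rs := [seq k%:R | k <- iota k0 (size p)]) p0.
rewrite size_map size_iota ltnn; apply.
  by apply/allP => _ /mapP[k + ->]; rewrite mem_iota => /andP[/rp].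
by rewrite map_inj_uniq ?iota_uniq // => i j /eqP; rewrite eqr_nat => /eqP.
Qed.

Definition wordform (R : comNzRingType) (D : nat) (I : finType)
    (f : (I -> R) -> R) :=
  exists phi : {ffun 'I_D -> I} -> R,
    forall x, f x = \sum_w phi w * \prod_t x (w t).

Lemma wordform_sum (R : comNzRingType) (D : nat) (I : finType) (J : Type)
    (r : seq J) (P : pred J) (F : J -> (I -> R) -> R) :
  (forall j, P j -> wordform D (F j)) ->
  wordform D (fun x => \sum_(j <- r | P j) F j x).
Proof.
move=> wF; elim: r => [|j r [phi E]].
  by exists (fun=> 0) => x; rewrite big_nil big1 // => w _; rewrite mul0r.
case: (boolP (P j)) => Pj; last by exists phi => x; rewrite big_cons (negPf Pj).
have [psi E'] := wF _ Pj; exists (fun w => psi w + phi w) => x.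
rewrite big_cons Pj E E' -big_split /=.
by apply: eq_bigr => w _; rewrite mulrDl.
Qed.

Lemma wordform_monomial (R : comNzRingType) (N : nat) (a : R) (m : 'X_{1..N}) :
  wordform (mdeg m) (fun x => a * \prod_(i < N) x i ^+ m i).
Proof.
pose w0 : {ffun 'I_(mdeg m) -> 'I_N} :=
  [ffun t => tnth (Tuple (introT eqP (size_m2s m))) t].
exists (fun w => a * (w == w0)%:R) => x.
rewrite (bigD1 w0) //= eqxx mulr1 [X in _ + X]big1 ?addr0; last first.
  by move=> w /negPf->; rewrite mulr0 mul0r.
congr (_ * _); transitivity (\prod_(i <- m2s m) x i).
  rewrite /m2s big_flatten big_map big_enum /=.
  by apply: eq_bigr => i _; rewrite big_nseq iter_mulr_1.
rewrite -[m2s m]/(val (Tuple (introT eqP (size_m2s m)))) big_tuple.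
by apply: eq_bigr => t _; rewrite ffunE.
Qed.

(** The words encode the degree [D] component of [P]. At a point [x] where [P] scales with degree
    [D], this component carries the whole value, as comparing coefficients of [z ^+ D] along the
    line through [x] shows. *)
Lemma mpoly_words (R : numDomainType) (N D : nat) (P : {mpoly R[N]}) :
  exists phi : {ffun 'I_D -> 'I_N} -> R, forall x : 'I_N -> R,
    (forall z : R, P.@[fun i => z * x i] = z ^+ D * P.@[x]) ->
    P.@[x] = \sum_w phi w * \prod_t x (w t).
Proof.
have [phi E] : wordform D (fun x => \sum_(m <- msupp P | mdeg m == D)
    P@_m * \prod_(i < N) x i ^+ m i).
  by apply: wordform_sum => m /eqP <-; apply: wordform_monomial.
exists phi => x H; rewrite -E.
pose q := \sum_(m <- msupp P) (P@_m * \prod_(i < N) x i ^+ m i) *: 'X^(mdeg m).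
have qE z : q.[z] = P.@[fun i => z * x i].
  rewrite mevalE horner_sum; apply: eq_bigr => m _.
  rewrite hornerZ hornerXn -mulrA; congr (_ * _).
  rewrite mulrC mdegE -prodrXr -big_split /=.
  by apply: eq_bigr => i _; rewrite exprMn.
have : q - P.@[x] *: 'X^D = 0.
  apply: (@poly_eq0_nat _ _ 0) => k _.
  by rewrite rootE hornerD hornerN hornerZ hornerXn qE H mulrC subrr.
move/subr0_eq/(congr1 (fun p : {poly R} => p`_D)).
rewrite coefZ coefXn eqxx mulr1 => <-.
rewrite coef_sum big_mkcond /= [RHS]big_mkcond /=; apply: eq_bigr => m _.
rewrite coefZ coefXn eq_sym; case: eqP => _; by rewrite ?mulr1 ?mulr0.
Qed.

(** * Reduction to matrices of determinant one *)

Lemma exists_root (R : rcfType) (n : nat) (d : R) :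
  (0 < n)%N -> 0 < d -> exists2 y, 0 < y & y ^+ n = d.
Proof.
move=> n0 d0.
(* The right end [1 + d] works for every [d > 0], since its [n]-th power is at least [1 + d]. *)
have [||y /andP[y0 _]] := @poly_ivtW R ('X^n - d%:P) 0 (1 + d).
- by rewrite addr_ge0 // ltW.
- rewrite !hornerE expr0n gtn_eqF // sub0r oppr_le0 ltW //= subr_ge0.
  apply: (@le_trans _ _ (1 + d)); first by rewrite ler_wpDl.
  by rewrite ler_eXnr // lerDl ltW.
rewrite rootE !hornerE subr_eq0 => /eqP yd; exists y => //.
rewrite lt_neqAle y0 andbT; apply: contraTneq d0 => y_eq0.
by rewrite -yd -y_eq0 expr0n gtn_eqF // ltxx.
Qed.

Lemma det_pos_scale (R : rcfType) (n : nat) (A : 'M[R]_n) :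
  (0 < n)%N -> 0 < \det A ->
  exists2 a : R, a ^+ n = \det A & exists2 A', \det A' = 1 & A = a *: A'.
Proof.
move=> n0 dA; have [a a0 aE] := exists_root n0 dA; exists a => //.
exists (a^-1 *: A); last by rewrite scalerA divff ?scale1r // gt_eqF.
by rewrite detZ exprVn aE mulVf // gt_eqF.
Qed.

(** The determinant is the characteristic polynomial of [- A] at [k], which is monic and hence
    eventually at least 1. *)
Lemma det_add_scalar_gt0 (R : realType) (n : nat) (A : 'M[R]_n) :
  exists k0 : nat, forall k : nat, (k0 <= k)%N -> 0 < \det (k%:R%:M + A).
Proof.
have lc1 : lead_coef (char_poly (- A)) = 1 by apply/eqP/char_poly_monic.
have [|x0 Hx] := @poly_pinfty_gt_lc _ (char_poly (- A)); first by rewrite lc1.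
exists (Num.Def.archi_bound `|x0|) => k lek.
have : x0 <= k%:R.
  apply: le_trans (ler_norm _) _; apply: ltW.
  by apply: lt_le_trans (archi_boundP (normr_ge0 x0)) _; rewrite ler_nat.
move/Hx; rewrite lc1 => /(lt_le_trans ltr01).
suff -> : (char_poly (- A)).[k%:R] = \det (k%:R%:M + A) by [].
rewrite -[LHS]/(horner_eval k%:R _) -det_map_mx; congr (\det _).
apply/matrixP => i j; rewrite !mxE /= /horner_eval !hornerE /= opprK.
by rewrite hornerMn hornerX.
Qed.

(** * Word expansion and equivariance on the invariant space *)

Definition rowix (m : nat) (n_ : 'I_m -> nat) : finType := {j : 'I_m & 'I_(n_ j)}.

(** The [pi j] are read as one stacked matrix, so that a monomial is a row word together with a
    column word. *)
Definition tent (R : Type) (m n : nat) (n_ : 'I_m -> nat)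
  (pi : forall j, 'M[R]_(n_ j, n)) (a : rowix n_) (e : 'I_n) : R :=
  pi (tag a) (tagged a) e.

(** Takes the place of functional extensionality for matrix tuples: a polynomial function sees only
    entries. *)
Lemma polynomial_fun_ext (R : realType) (m n : nat) (n_ : 'I_m -> nat)
    (Phi : mxtuple R n n_ -> R) (pi pi' : mxtuple R n n_) :
  polynomial_fun Phi -> (forall j, pi j = pi' j) -> Phi pi = Phi pi'.
Proof.
move=> [P PE] E; rewrite !PE; apply: meval_eq => i.
by rewrite /coords /= E.
Qed.

(** Scaling all [pi j] by one common factor makes [Phi] homogeneous of total degree [D], so
    [mpoly_words] applies. *)
Lemma in_V_words (R : realType) (m n : nat) (n_ : 'I_m -> nat)
    (p : 'I_m -> rat) (s D : nat) (Phi : mxtuple R n n_ -> R) :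
  (\sum_(j < m) mdegree n_ p s j)%N = D -> in_V p s Phi ->
  exists phi : {ffun 'I_D -> rowix n_} -> {ffun 'I_D -> 'I_n} -> R,
    forall pi, Phi pi = \sum_i \sum_e phi i e * \prod_t tent pi (i t) (e t).
Proof.
move=> DE [PolyPhi Hom _]; have [P PE] := PolyPhi.
have [phi0 phi0E] := mpoly_words D P.
pose row (w : {ffun 'I_D -> 'I_#|entry n n_|}) : {ffun 'I_D -> rowix n_} :=
  [ffun t => let u := enum_val (w t) in Tagged (fun j => 'I_(n_ j)) (tagged u).1].
pose col (w : {ffun 'I_D -> 'I_#|entry n n_|}) : {ffun 'I_D -> 'I_n} :=
  [ffun t => (tagged (enum_val (w t))).2].
exists (fun i e => \sum_w phi0 w * ((row w == i) && (col w == e))%:R) => pi.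
have homP z : P.@[fun i => z * coords pi i] = z ^+ D * P.@[coords pi].
  have := Hom (fun=> z) pi; rewrite !PE prodrXr DE => <-.
  by apply: meval_eq => i; rewrite /coords /= mxE.
rewrite PE phi0E //.
transitivity (\sum_i \sum_e \sum_w phi0 w * ((row w == i) && (col w == e))%:R *
    \prod_t tent pi (i t) (e t)); last first.
  by apply: eq_bigr => i _; apply: eq_bigr => e _; rewrite mulr_suml.
under [RHS]eq_bigr do rewrite exchange_big /=.
rewrite exchange_big /=; apply: eq_bigr => w _.
rewrite (bigD1 (row w)) //= [X in _ = _ + X]big1 ?addr0; last first.
  by move=> i /negPf ni; rewrite big1 // => e _; rewrite eq_sym ni mulr0 mul0r.
rewrite (bigD1 (col w)) //= [X in _ = _ + X]big1 ?addr0; last first.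
  by move=> e /negPf ne; rewrite [_ == e]eq_sym ne andbF mulr0 mul0r.
rewrite !eqxx mulr1; congr (_ * _).
by apply: eq_bigr => t _; rewrite !ffunE.
Qed.

(** Each matrix is a scalar times a matrix of determinant 1. Homogeneity turns the scalars into
    powers of determinants, because the degree in [pi j] is [n_ j] times [nblocks p s j] and the
    total degree is [n * s]. *)
Lemma in_V_det_gt0 (R : realType) (m n : nat) (n_ : 'I_m -> nat)
    (p : 'I_m -> rat) (s : nat) (Phi : mxtuple R n n_ -> R)
    (A_ : forall j, 'M[R]_(n_ j)) (A : 'M[R]_n) (pi : mxtuple R n n_) :
  (0 < n)%N -> (forall j, (0 < n_ j)%N) ->
  (\sum_(j < m) mdegree n_ p s j)%N = (n * s)%N -> in_V p s Phi ->
  (forall j, 0 < \det (A_ j)) -> 0 < \det A ->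
  Phi (fun j => A_ j *m pi j *m A^T) =
  (\prod_j \det (A_ j) ^+ nblocks p s j) * \det A ^+ s * Phi pi.
Proof.
move=> n0 n_0 DE [PolyPhi Hom Inv] dA_ dA.
have [a aE [A' dA' ->]] := det_pos_scale n0 dA.
have /fin_all_exists[a_ /fin_all_exists[A_' H]] j :
    exists (a : R) (A' : 'M[R]_(n_ j)),
    [/\ a ^+ n_ j = \det (A_ j), \det A' = 1 & A_ j = a *: A'].
  by have [b ? [B ? ?]] := det_pos_scale (n_0 j) (dA_ j); exists b, B.
transitivity (Phi (fun j => (a_ j * a) *: (A_' j *m pi j *m A'^T))).
  apply: polynomial_fun_ext => // j; have [_ _ ->] := H j.
  by rewrite linearZ /= -!scalemxAl -scalemxAr scalerA.
rewrite (Hom (fun j => a_ j * a)) Inv //; last by move=> j; have [] := H j.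
congr (_ * _).
under [LHS]eq_bigr do rewrite exprMn; rewrite big_split /=; congr (_ * _).
  apply: eq_bigr => j _; have [<- _ _] := H j.
  by rewrite /mdegree mulnC exprM.
by rewrite prodrXr DE exprM detZ dA' mulr1.
Qed.

(** Adding [z] times the identity to every matrix makes both sides polynomials in [z]. They agree at
    all large integers, where the determinants are positive, hence also at [z = 0]. *)
Lemma in_V_det (R : realType) (m n : nat) (n_ : 'I_m -> nat)
    (p : 'I_m -> rat) (s : nat) (Phi : mxtuple R n n_ -> R)
    (A_ : forall j, 'M[R]_(n_ j)) (A : 'M[R]_n) (pi : mxtuple R n n_) :
  (0 < n)%N -> (forall j, (0 < n_ j)%N) ->
  (\sum_(j < m) mdegree n_ p s j)%N = (n * s)%N -> in_V p s Phi ->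
  Phi (fun j => A_ j *m pi j *m A^T) =
  (\prod_j \det (A_ j) ^+ nblocks p s j) * \det A ^+ s * Phi pi.
Proof.
move=> n0 n_0 DE VPhi; have [phi phiE] := in_V_words DE VPhi.
pose sh k (B : 'M[R]_k) : 'M[{poly R}]_k := 'X%:M + map_mx polyC B.
have evsh z k (B : 'M[R]_k) : map_mx (horner_eval z) (sh k B) = z%:M + B.
  apply/matrixP => i j; rewrite !mxE /= /horner_eval !hornerE /=.
  by rewrite hornerMn hornerX.
pose qi : forall j, 'M[{poly R}]_(n_ j, n) := fun j =>
  sh _ (A_ j) *m map_mx polyC (pi j) *m (sh _ A)^T.
(* [Phi] takes only real matrices; its word expansion is what can be evaluated on matrices with
   polynomial entries. *)
pose q1 : {poly R} := \sum_i \sum_e (phi i e)%:P * \prod_t tent qi (i t) (e t).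
pose q2 : {poly R} := (\prod_j \det (sh _ (A_ j)) ^+ nblocks p s j) *
  \det (sh _ A) ^+ s * (Phi pi)%:P.
have q1E z : q1.[z] = Phi (fun j => (z%:M + A_ j) *m pi j *m (z%:M + A)^T).
  rewrite phiE horner_sum; apply: eq_bigr => i _.
  rewrite horner_sum; apply: eq_bigr => e _.
  rewrite hornerM hornerC; congr (_ * _).
  rewrite horner_prod; apply: eq_bigr => t _.
  rewrite /tent -[LHS]/(horner_eval z _) -!evsh.
  transitivity (map_mx (horner_eval z) (qi (tag (i t))) (tagged (i t)) (e t)).
    by rewrite [RHS]mxE.
  rewrite !map_mxM map_trmx; congr ((_ *m _ *m _) _ _).
  by apply/matrixP => a b; rewrite !mxE /= /horner_eval hornerC.
have q2E z : q2.[z] = (\prod_j \det (z%:M + A_ j) ^+ nblocks p s j) *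
    \det (z%:M + A) ^+ s * Phi pi.
  rewrite !hornerM hornerC horner_exp horner_prod; congr (_ * _ ^+ _ * _).
    apply: eq_bigr => j _; rewrite horner_exp -[X in X ^+ _]/(horner_eval z _).
    by rewrite -det_map_mx evsh.
  by rewrite -[LHS]/(horner_eval z _) -det_map_mx evsh.
have /fin_all_exists[k_ Hk_] j := det_add_scalar_gt0 (A_ j).
have [k Hk] := det_add_scalar_gt0 A.
have : q1 - q2 = 0.
  apply: (@poly_eq0_nat _ _ (maxn k (\max_j k_ j))) => l.
  rewrite geq_max => /andP[kl /bigmax_leqP kl_].
  rewrite rootE hornerD hornerN q1E q2E (in_V_det_gt0 _ n0 n_0 DE VPhi) ?subrr //.
    by move=> j; apply: Hk_; apply: kl_.
  exact: Hk.
move/subr0_eq/(congr1 (horner_eval 0)); rewrite /horner_eval q1E q2E.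
rewrite raddf0 !add0r => E; rewrite -[X in _ * X]/(Phi pi).
transitivity (Phi (fun j => (0%:M + A_ j) *m pi j *m A^T)).
  by case: VPhi => PolyPhi _ _; apply: polynomial_fun_ext => // j; rewrite raddf0 add0r.
rewrite E; congr (_ * _ * _); apply: eq_bigr => j _.
by rewrite raddf0 add0r.
Qed.

(** * Block diagonal matrices and the indexing of rows and columns *)

Import tagnat.

Lemma det_castmx (R : comNzRingType) (a b : nat) (e e' : a = b) (A : 'M[R]_a) :
  \det (castmx (e, e') A) = \det A.
Proof. by case: b / e e' => e'; rewrite (eq_axiomK e') castmx_id. Qed.

Lemma castmx_mul3 (R : comNzRingType) (a b d : nat) (e1 : a = d) (e2 : b = d)
    (X : 'M[R]_a) (Y : 'M[R]_(a, b)) (Z : 'M[R]_b) :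
  castmx (e1, e2) (X *m Y *m Z) =
  castmx (e1, e1) X *m castmx (e1, e2) Y *m castmx (e2, e2) Z.
Proof. by case: d / e1 e2 => e2; case: a / e2 X Y. Qed.

Lemma det_mxdiag (R : comNzRingType) (m : nat) (p_ : 'I_m -> nat)
    (B : forall i, 'M[R]_(p_ i)) :
  \det (\mxdiag_i B i) = \prod_i \det (B i).
Proof.
elim: m p_ B => [|m IH] p_ B.
  rewrite [RHS]big_ord0; move: (\mxdiag_i B i); rewrite big_ord0 => A.
  exact: det_mx00.
by rewrite mxdiag_recl det_castmx det_ublock IH big_ord_recl.
Qed.

(** Block sizes vary with [i]; describing entries by [f] on tagged indices avoids transport between
    matrix types. *)
Lemma mxdiag_entry (R : nmodType) (m : nat) (p_ : 'I_m -> nat)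
    (B : forall i, 'M[R]_(p_ i)) (f : {i & 'I_(p_ i)} -> {i & 'I_(p_ i)} -> R) x y :
  (forall i a b, f (Tagged _ a) (Tagged _ b) = B i a b) ->
  (\mxdiag_i B i) x y =
  if sig1 x == sig1 y then f (Tagged _ (sig2 x)) (Tagged _ (sig2 y)) else 0.
Proof.
move=> fE; rewrite mxE; move: (sig2 x) (sig2 y).
case: eqP => [<-|_] a b; last by rewrite mxE.
by rewrite conform_mx_id fE.
Qed.

Lemma blockdetE (R : comNzRingType) (D : nat) (X : finType) (Y : eqType)
    (blk : 'I_D -> Y) (q : 'I_D -> X) (x : X -> X -> R) :
  blockdet blk q x =
  \det (\matrix_(t, u) (if blk t == blk u then x (q t) (q u) else 0)).
Proof.
rewrite /blockdet big_mkcond; apply: eq_bigr => tau _.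
case: ifPn => [/forallP H|].
  congr (_ * _); apply: eq_bigr => t _; rewrite mxE.
  by rewrite eq_sym H.
rewrite negb_forall => /existsP[t ht].
by rewrite (bigD1 t) //= mxE eq_sym (negPf ht) mul0r mulr0.
Qed.

Section Index.
Variables (m n s D : nat) (n_ N : 'I_m -> nat).
Variables (eR : (\sum_(j < m) \sum_(k < N j) n_ j)%N = D).
Variables (eC : (\sum_(l < s) n)%N = D).

(** A row slot is located by its block row [(j, k)], and [rix] gives the row of [pi j] that it
    carries; [cblk] and [cix] do the same for columns. Both sides use the index type ['I_D], so
    permutations can match them. *)
Definition rblk (t : 'I_D) : {j : 'I_m & 'I_(N j)} :=
  let x := cast_ord (esym eR) t in Tagged (fun j => 'I_(N j)) (sig1 (sig2 x)).
Definition rix (t : 'I_D) : rowix n_ :=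
  let x := cast_ord (esym eR) t in Tagged (fun j => 'I_(n_ j)) (sig2 (sig2 x)).
Definition cblk (u : 'I_D) : 'I_s := sig1 (cast_ord (esym eC) u).
Definition cix (u : 'I_D) : 'I_n := sig2 (cast_ord (esym eC) u).

Lemma rblk_rix_inj t u : rblk t = rblk u -> rix t = rix u -> t = u.
Proof.
rewrite /rblk /rix /sig1 /sig2 => E1 E2; apply: (@cast_ord_inj _ _ (esym eR)).
apply: (can_inj sigK); move: (sig (cast_ord _ t)) (sig (cast_ord _ u)) E1 E2.
move=> [j a] [j' b] /= E1; have ej : j = j' := congr1 tag E1.
case: j' / ej b E1 => b /eqP; rewrite eq_Tagged /= => /eqP E1 /eqP.
rewrite eq_Tagged /= => /eqP E2; congr (Tagged _ _); apply: (can_inj sigK).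
move: (sig a) (sig b) E1 E2 => [k c] [k' d] /= E1.
by case: k' / E1 d => d ->.
Qed.

Lemma cblk_cix_inj t u : cblk t = cblk u -> cix t = cix u -> t = u.
Proof.
rewrite /cblk /cix /sig1 /sig2 => E1 E2; apply: (@cast_ord_inj _ _ (esym eC)).
apply: (can_inj sigK); move: (sig (cast_ord _ t)) (sig (cast_ord _ u)) E1 E2.
by move=> [l c] [l' d] /= E1; case: l' / E1 d => d ->.
Qed.

Lemma tag_rblk t : tag (rblk t) = tag (rix t). Proof. by []. Qed.


(** Links [blockdet] to [in_V_det]: the matrix is block diagonal with [N j] copies of the [j]-th
    matrix, which yields the determinant factor of the row action. *)
Lemma blockdet_row (R : comNzRingType) (x : rowix n_ -> rowix n_ -> R) :
  blockdet rblk rix x =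
  \prod_j \det (\matrix_(a, b) x (Tagged _ a) (Tagged _ b) : 'M_(n_ j)) ^+ N j.
Proof.
pose A j : 'M[R]_(n_ j) := \matrix_(a, b) x (Tagged _ a) (Tagged _ b).
transitivity (\det (\mxdiag_(j < m) \mxdiag_(k < N j) A j)); last first.
  rewrite det_mxdiag; apply: eq_bigr => j _.
  by rewrite det_mxdiag prodr_const card_ord.
rewrite -(det_castmx eR eR) blockdetE; congr (\det _); apply/matrixP => t u.
rewrite castmxE mxE.
pose f (X Y : {j : 'I_m & 'I_(\sum_(k < N j) n_ j)}) : R :=
  if (Tagged (fun j => 'I_(N j)) (sig1 (tagged X))) ==
     (Tagged (fun j => 'I_(N j)) (sig1 (tagged Y)))
  then x (Tagged _ (sig2 (tagged X))) (Tagged _ (sig2 (tagged Y))) else 0.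
rewrite (mxdiag_entry (f := f)) /f /=; last first.
  move=> j a b; rewrite eq_Tagged /=.
  rewrite (mxdiag_entry
    (f := fun c d : {k : 'I_(N j) & 'I_(n_ j)} =>
      x (Tagged (fun j => 'I_(n_ j)) (tagged c))
        (Tagged (fun j => 'I_(n_ j)) (tagged d)))) //.
  by move=> k c d; rewrite mxE.
rewrite -/(rblk t) -/(rblk u) -/(rix t) -/(rix u).
case: eqP => [E|]; last by rewrite if_same.
by have /= -> := congr1 tag E; rewrite eqxx.
Qed.

Lemma blockdet_col (R : comNzRingType) (x : 'I_n -> 'I_n -> R) :
  blockdet cblk cix x = \det (\matrix_(a, b) x a b) ^+ s.
Proof.
transitivity (\det (\mxdiag_(l < s) (\matrix_(a, b) x a b))); last first.
  by rewrite det_mxdiag prodr_const card_ord.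
rewrite -(det_castmx eC eC) blockdetE; congr (\det _); apply/matrixP => t u.
rewrite castmxE mxE.
by rewrite (mxdiag_entry (f := fun c d : {l : 'I_s & 'I_n} => x (tagged c) (tagged d))) // => l a b; rewrite mxE.
Qed.

End Index.

(** * Block determinants belong to the invariant space *)

Lemma castmx_blocksE (R : realType) (m n : nat) (n_ : 'I_m -> nat)
    (p : 'I_m -> rat) (s D : nat)
    (eR : (\sum_(j < m) \sum_(k < nblocks p s j) n_ j)%N = D)
    (eC : (\sum_(l < s) n)%N = D) (c : coefs R p s) (pi : mxtuple R n n_) t u :
  castmx (eR, eC) (blocks c pi) t u =
  c (tag (rblk eR t)) (tagged (rblk eR t)) (cblk eC u) *
    tent pi (rix eR t) (cix eC u).
Proof. by rewrite castmxE !mxE. Qed.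

(** The action multiplies the block matrix on the left by copies of the [A_ j] and on the right by
    copies of [A^T], both block diagonal. *)
Lemma det_blocks_mul (R : realType) (m n : nat) (n_ : 'I_m -> nat)
    (p : 'I_m -> rat) (s D : nat)
    (eR : (\sum_(j < m) \sum_(k < nblocks p s j) n_ j)%N = D)
    (eC : (\sum_(l < s) n)%N = D) (c : coefs R p s) (pi : mxtuple R n n_)
    (A_ : forall j, 'M[R]_(n_ j)) (A : 'M[R]_n) :
  \det (castmx (eR, eC) (blocks c (fun j => A_ j *m pi j *m A^T))) =
  (\prod_j \det (A_ j) ^+ nblocks p s j) * \det A ^+ s *
    \det (castmx (eR, eC) (blocks c pi)).
Proof.
have -> : blocks c (fun j => A_ j *m pi j *m A^T) =
    (\mxdiag_(j < m) \mxdiag_(k < nblocks p s j) A_ j) *m blocks c pi *m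
    (\mxdiag_(l < s) A^T).
  rewrite /blocks mul_mxdiag_mxcol mxcol_mul; apply: eq_mxcol => j.
  rewrite mul_mxdiag_mxcol mxcol_mul; apply: eq_mxcol => k.
  rewrite mul_mxrow mul_mxrow_mxdiag; apply: eq_mxrow => l.
  by rewrite -scalemxAr -scalemxAl.
rewrite castmx_mul3 !det_mulmx !det_castmx !det_mxdiag mulrAC; congr (_ * _ * _).
  by apply: eq_bigr => j _; rewrite det_mxdiag prodr_const card_ord.
by rewrite prodr_const card_ord det_tr.
Qed.

Lemma det_blocks_polynomial (R : realType) (m n : nat) (n_ : 'I_m -> nat)
    (p : 'I_m -> rat) (s D : nat)
    (eR : (\sum_(j < m) \sum_(k < nblocks p s j) n_ j)%N = D)
    (eC : (\sum_(l < s) n)%N = D) (c : coefs R p s) :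
  polynomial_fun (fun pi : mxtuple R n n_ => \det (castmx (eR, eC) (blocks c pi))).
Proof.
pose v t u : entry n n_ :=
  Tagged (fun j => ('I_(n_ j) * 'I_n)%type) (tagged (rix eR t), cix eC u).
exists (\det (\matrix_(t, u) (c (tag (rblk eR t)) (tagged (rblk eR t)) (cblk eC u)
  *: 'X_(enum_rank (v t u))))) => pi.
rewrite -det_map_mx; congr (\det _); apply/matrixP => t u.
rewrite castmx_blocksE !mxE /= mevalZ mevalXU; congr (_ * _).
by rewrite /coords enum_rankK.
Qed.

Lemma sum_mdegree (m : nat) (n_ : 'I_m -> nat) (p : 'I_m -> rat) (s : nat) :
  (\sum_(j < m) mdegree n_ p s j = \sum_(j < m) \sum_(k < nblocks p s j) n_ j)%N.
Proof. by apply: eq_bigr => j _; rewrite sum_nat_const card_ord. Qed.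

(** Both conditions specialize [det_blocks_mul]: invariance by setting all determinants to 1,
    homogeneity by taking scalar matrices [A_ j] and [A = 1]. *)
Lemma span_block_det_in_V (R : realType) (m n : nat) (n_ : 'I_m -> nat)
    (p : 'I_m -> rat) (s : nat)
    (e : (\sum_(j < m) \sum_(k < nblocks p s j) n_ j)%N = (n * s)%N)
    (Phi : mxtuple R n n_ -> R) :
  in_span (block_det e) Phi -> in_V p s Phi.
Proof.
move=> [K [a [D [SD PhiE]]]].
have /fin_all_exists2[c _ DE] := SD.
have mulD A_ A pi : Phi (fun j => A_ j *m pi j *m A^T) =
    (\prod_j \det (A_ j) ^+ nblocks p s j) * \det A ^+ s * Phi pi.
  rewrite !PhiE mulr_sumr; apply: eq_bigr => i _.
  by rewrite !DE det_blocks_mul mulrCA.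
have PolyPhi : polynomial_fun Phi.
  have /fin_all_exists[P PE] i : polynomial_fun (D i).
    have [P PE] := det_blocks_polynomial e (block_width n s) (c i).
    by exists P => pi; rewrite DE.
  exists (\sum_i a i *: P i) => pi; rewrite PhiE raddf_sum /=.
  by apply: eq_bigr => i _; rewrite mevalZ PE.
split=> // [lam pi|A_ A pi dA_ dA]; last first.
  by rewrite mulD dA expr1n mulr1 big1 ?mul1r // => j _; rewrite dA_ expr1n.
have := mulD (fun j => (lam j)%:M) 1%:M pi.
rewrite det1 expr1n mulr1 /= => E.
transitivity (Phi (fun j => (lam j)%:M *m pi j *m 1%:M^T)).
  by apply: polynomial_fun_ext => // j; rewrite trmx1 mulmx1 mul_scalar_mx.
rewrite E; congr (_ * _); apply: eq_bigr => j _.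
by rewrite det_scalar -exprM mulnC.
Qed.

(** * Block determinants span the invariant space *)

Section SpanningSet.
Variables (R : realType) (m n : nat) (n_ : 'I_m -> nat) (p : 'I_m -> rat) (s : nat).
Variable e : (\sum_(j < m) \sum_(k < nblocks p s j) n_ j)%N = (n * s)%N.
Notation eC := (block_width n s).

(** These are the factors of [g t u] in [contraction_det], which depend on [t] and [u] only through
    their blocks. *)
Definition count_coefs (kap : 'S_(n * s)) (S : {set 'I_(n * s)}) : coefs R p s :=
  fun j => \matrix_(k, l) (\sum_(t in S)
    ((rblk e t == Tagged _ k) && (cblk eC (kap t) == l))%:R).

Lemma count_coefs_neq0 kap S j k l : count_coefs kap S j k l != 0 ->
  exists2 t, rblk e t = Tagged _ k & cblk eC (kap t) = l.
Proof.
rewrite mxE => H.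
have [t /andP[/eqP ? /eqP ?]] : exists t,
    (rblk e t == Tagged _ k) && (cblk eC (kap t) == l).
  apply/existsP; apply: contraTT H; rewrite negb_exists negbK => /forallP H.
  by rewrite big1 // => t _; rewrite (negPf (H t)).
by exists t.
Qed.

(** A nonzero coefficient needs a slot [t] in its block row with [kap t] in its block column. A
    block row for [j] has at most [n_ j] slots, and since [kap] is injective at most [n] slots are
    sent to a given block column. *)
Lemma sparse_count_coefs kap S : sparse n n_ (count_coefs kap S).
Proof.
split=> [j k|l].
  pose A := [set t | rblk e t == Tagged (fun j => 'I_(nblocks p s j)) k].
  apply: (@leq_trans #|(fun t => cblk eC (kap t)) @: A|).
    apply/subset_leq_card/subsetP => l; rewrite inE => /count_coefs_neq0[t tk <-].
    by apply: imset_f; rewrite inE tk.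
  apply: leq_trans (leq_imset_card _ _) _.
  pose B := [set a : rowix n_ | tag a == j].
  have inj : {in A &, injective (rix e)}.
    move=> t u; rewrite !inE => /eqP tk /eqP uk.
    by apply: rblk_rix_inj; rewrite tk uk.
  rewrite -(card_in_imset inj); apply: (@leq_trans #|(fun a : 'I_(n_ j) =>
      Tagged (fun j => 'I_(n_ j)) a : rowix n_) @: setT|); last first.
    by apply: leq_trans (leq_imset_card _ _) _; rewrite cardsT card_ord.
  apply/subset_leq_card/subsetP => _ /imsetP[t + ->]; rewrite inE => /eqP tk.
  have : tag (rix e t) = j by rewrite -tag_rblk tk.
  by case: (rix e t) => j' a /= jj; case: j / jj a {B inj A k tk} => a; apply: imset_f.
pose A := [set t | cblk eC (kap t) == l].
apply: (@leq_trans #|rblk e @: A|).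
  apply/subset_leq_card/subsetP => -[j k]; rewrite inE => /count_coefs_neq0[t tk tl].
  by rewrite -[existT _ _ _]tk; apply: imset_f; rewrite inE tl.
apply: leq_trans (leq_imset_card _ _) _.
have inj : {in A &, injective (fun t => cix eC (kap t))}.
  move=> t u; rewrite !inE => /eqP tk /eqP uk /= E; apply: (@perm_inj _ kap).
  by apply: cblk_cix_inj E; rewrite tk uk.
by rewrite -(card_in_imset inj) -[n in (_ <= n)%N]card_ord max_card.
Qed.

(** The indicator keeps rows of different [pi j] apart, so that [A_] may be an arbitrary function on
    pairs of row letters, as [blockdet_pairing] requires. *)
Lemma tent_mul (A_ : rowix n_ -> rowix n_ -> R) (A : 'I_n -> 'I_n -> R)
    (pi : mxtuple R n n_) i f :
  tent (fun j => (\matrix_(a, b) A_ (Tagged _ a) (Tagged _ b)) *m pi j *m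
                 (\matrix_(a, b) A a b)^T) i f =
  \sum_a \sum_b (tag i == tag a)%:R * A_ i a * tent pi a b * A f b.
Proof.
case: i => j i; rewrite /tent /= !mxE exchange_big /=.
under [RHS]eq_bigr do rewrite -mulr_suml.
apply: eq_bigr => b _; rewrite !mxE; congr (_ * _).
pose F j' (a : 'I_(n_ j')) : R :=
  (j == j')%:R * A_ (Tagged (fun j => 'I_(n_ j)) i)
    (Tagged (fun j => 'I_(n_ j)) a) * pi j' a b.
transitivity (\sum_j' \sum_(a : 'I_(n_ j')) F j' a); last first.
  by rewrite (sig_big_dep _ _ F) /=; apply: eq_bigr => -[].
rewrite (bigD1 j) //= [X in _ = _ + X]big1 ?addr0; last first.
  by move=> j' /negPf jj'; apply: big1 => a _; rewrite /F eq_sym jj' !mul0r.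
by apply: eq_bigr => a _; rewrite /F eqxx mul1r mxE.
Qed.

Lemma prod_tent_mul (A_ : rowix n_ -> rowix n_ -> R) (A : 'I_n -> 'I_n -> R)
    (pi : mxtuple R n n_) (D : nat) (i : 'I_D -> rowix n_) (f : 'I_D -> 'I_n) :
  \prod_t tent (fun j => (\matrix_(a, b) A_ (Tagged _ a) (Tagged _ b)) *m pi j *m
                 (\matrix_(a, b) A a b)^T) (i t) (f t) =
  \sum_(a : {ffun 'I_D -> rowix n_}) \sum_(b : {ffun 'I_D -> 'I_n})
     (\prod_t (tag (i t) == tag (a t))%:R) * (\prod_t A_ (i t) (a t)) *
     (\prod_t tent pi (a t) (b t)) * (\prod_t A (f t) (b t)).
Proof.
under eq_bigr do rewrite tent_mul.
rewrite bigA_distr_bigA; apply: eq_bigr => a _.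
rewrite bigA_distr_bigA; apply: eq_bigr => b _.
by rewrite !big_split.
Qed.

Lemma in_V_contraction (Phi : mxtuple R n n_ -> R)
    (n0 : (0 < n)%N) (n_0 : forall j, (0 < n_ j)%N) :
  in_V p s Phi ->
  exists w : 'S_(n * s) -> 'S_(n * s) -> R, forall pi,
    Phi pi = \sum_sg' \sum_sg w sg' sg *
      \sum_(tau | blockperm (rblk e) tau) \sum_(rho | blockperm (cblk eC) rho)
        (-1) ^+ tau * ((-1) ^+ rho *
        \prod_t tent pi (rix e ((sg' * tau)%g t)) (cix eC ((sg * rho)%g t))).
Proof.
move=> VPhi; have DE : (\sum_(j < m) mdegree n_ p s j)%N = (n * s)%N.
  by rewrite sum_mdegree.
have [phi phiE] := in_V_words DE VPhi.
have [cR cR0 HR] := blockdet_pairing R (@rblk_rix_inj _ _ _ _ e).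
have [cC cC0 HC] := blockdet_pairing R (@cblk_cix_inj _ _ _ eC).
exists (fun sg' sg => (cR * cC)^-1 * phi (wcomp (rix e) sg') (wcomp (cix eC) sg)) => pi.
pose T := 'I_(n * s).
pose mask (i a : {ffun T -> rowix n_}) : R := \prod_t (tag (i t) == tag (a t))%:R.
pose P (a : {ffun T -> rowix n_}) (b : {ffun T -> 'I_n}) := \prod_t tent pi (a t) (b t).
(* First pairing, in the entries of [A] with [A_] fixed: it removes [A] and leaves an identity of
   forms in [A_]. *)
have key A_ : \sum_i \sum_a (\sum_(rho | blockperm (cblk eC) rho) (-1) ^+ rho *
      \sum_(sg : 'S_(n * s)) phi i (wcomp (cix eC) sg) * mask i a *
        P a (wcomp (cix eC) (sg * rho)%g)) * \prod_t A_ (i t) (a t) =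
    cC * Phi pi * blockdet (rblk e) (rix e) A_.
  pose psi f b := \sum_i \sum_a phi i f * mask i a * (\prod_t A_ (i t) (a t)) * P a b.
  transitivity (\sum_(rho | blockperm (cblk eC) rho) (-1) ^+ rho *
      \sum_(sg : 'S_(n * s)) psi (wcomp (cix eC) sg) (wcomp (cix eC) (sg * rho)%g)).
    transitivity (\sum_(rho | blockperm (cblk eC) rho) \sum_(sg : 'S_(n * s))
        \sum_i \sum_a (-1) ^+ rho * (phi i (wcomp (cix eC) sg) * mask i a *
          (\prod_t A_ (i t) (a t)) * P a (wcomp (cix eC) (sg * rho)%g))); last first.
      apply: eq_bigr => rho _; rewrite mulr_sumr; apply: eq_bigr => sg _.
      by rewrite mulr_sumr; apply: eq_bigr => i _; rewrite mulr_sumr.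
    under [RHS]eq_bigr do rewrite exchange_big; rewrite [RHS]exchange_big /=.
    apply: eq_bigr => i _.
    under [RHS]eq_bigr do rewrite exchange_big; rewrite [RHS]exchange_big /=.
    apply: eq_bigr => a _; rewrite mulr_suml; apply: eq_bigr => rho _.
    rewrite -mulrA mulr_suml mulr_sumr; apply: eq_bigr => sg _.
    by rewrite mulrAC.
  rewrite (HC psi (blockdet (rblk e) (rix e) A_ * Phi pi)); first by rewrite mulrCA mulrC.
  move=> A; rewrite blockdet_row blockdet_col.
  transitivity (Phi (fun j => (\matrix_(a, b) A_ (Tagged _ a) (Tagged _ b)) *m pi j *m
                 (\matrix_(a, b) A a b)^T)); last first.
    by rewrite (in_V_det _ _ _ n0 n_0 DE VPhi) mulrAC.
  rewrite phiE.
  transitivity (\sum_f \sum_b \sum_i \sum_a phi i f * (mask i a *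
      (\prod_t A_ (i t) (a t)) * P a b * \prod_t A (f t) (b t))).
    apply: eq_bigr => f _; apply: eq_bigr => b _; rewrite mulr_suml.
    by apply: eq_bigr => i _; rewrite mulr_suml; apply: eq_bigr => a _; rewrite !mulrA.
  under [LHS]eq_bigr do rewrite exchange_big; rewrite [LHS]exchange_big /=.
  apply: eq_bigr => i _; apply: eq_bigr => f _; rewrite prod_tent_mul.
  rewrite exchange_big mulr_sumr; apply: eq_bigr => a _; rewrite mulr_sumr.
  exact: eq_bigr.
(* Second pairing, in the entries of [A_]; dividing by the nonzero constant [cR * cC] isolates
   [Phi pi]. *)
have /(congr1 ( *%R (cR * cC)^-1)) := HR _ _ key.
rewrite [cR * (_ * _)]mulrA mulKf ?mulf_neq0 // => <-.
under eq_bigr do rewrite mulr_sumr; rewrite exchange_big mulr_sumr /=.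
apply: eq_bigr => sg' _; rewrite mulr_sumr.
transitivity (\sum_(tau | blockperm (rblk e) tau)
    \sum_(rho | blockperm (cblk eC) rho) \sum_sg (cR * cC)^-1 *
    (phi (wcomp (rix e) sg') (wcomp (cix eC) sg) * ((-1) ^+ tau * ((-1) ^+ rho *
    P (wcomp (rix e) (sg' * tau)%g) (wcomp (cix eC) (sg * rho)%g))))).
  apply: eq_bigr => tau /forallP btau; rewrite !mulr_sumr; apply: eq_bigr => rho _.
  rewrite !mulr_sumr; apply: eq_bigr => sg _; congr (_ * _).
  (* The mask equals 1 here: [tau] preserves block rows, so the paired row letters have the same
     tag. *)
  rewrite /mask big1 ?mulr1 => [|t _]; first by rewrite [in LHS](mulrCA ((-1) ^+ rho)) [LHS]mulrCA.
  by rewrite !ffunE permM -!tag_rblk (eqP (btau _)) eqxx.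
under [LHS]eq_bigr do rewrite exchange_big; rewrite [LHS]exchange_big /=.
apply: eq_bigr => sg _; rewrite mulr_sumr; apply: eq_bigr => tau _.
rewrite mulr_sumr; apply: eq_bigr => rho _; rewrite -mulrA; congr (_ * (_ * (_ * (_ * _)))).
by apply: eq_bigr => t _; rewrite !ffunE.
Qed.

(** Each contraction is expanded by [contraction_det]; the spanning family is indexed by the triples
    of [sg'], [sg] and [S], with both signs absorbed into the scalar coefficients. *)
Lemma in_V_span_block_det (Phi : mxtuple R n n_ -> R)
    (n0 : (0 < n)%N) (n_0 : forall j, (0 < n_ j)%N) :
  in_V p s Phi -> in_span (block_det e) Phi.
Proof.
move=> /(in_V_contraction n0 n_0)[w wE].
pose J : finType := ('S_(n * s) * 'S_(n * s) * {set 'I_(n * s)})%type.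
pose kap (x : J) := (x.1.1^-1 * x.1.2)%g.
exists #|J|, (fun i => let x : J := enum_val i in
  w x.1.1 x.1.2 * ((-1) ^+ kap x * (-1) ^+ #|~: x.2|)).
exists (fun i pi => let x : J := enum_val i in
  \det (castmx (e, eC) (blocks (count_coefs (kap x) x.2) pi))).
split=> [i|pi].
  by exists (count_coefs (kap (enum_val i)) (enum_val i).2) => //;
    apply: sparse_count_coefs.
rewrite wE /= -(big_enum_val (fun x : J => w x.1.1 x.1.2 *
   ((-1) ^+ kap x * (-1) ^+ #|~: x.2|) *
   \det (castmx (e, eC) (blocks (count_coefs (kap x) x.2) pi)))) /=.
rewrite -(pair_bigA _ (fun x S => w x.1 x.2 *
   ((-1) ^+ (x.1^-1 * x.2)%g * (-1) ^+ #|~: S|) *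
   \det (castmx (e, eC) (blocks (count_coefs (x.1^-1 * x.2)%g S) pi)))) /=.
rewrite pair_bigA /=; apply: eq_bigr => -[sg' sg] _ /=.
rewrite (contraction_det _ _ (fun t u => tent pi (rix e t) (cix eC u))).
rewrite !mulr_sumr; apply: eq_bigr => S _.
rewrite -!mulrA; congr (_ * (_ * (_ * \det _))).
apply/matrixP => t u; rewrite castmx_blocksE !mxE; congr (_ * _).
Qed.

End SpanningSet.

Theorem lemma3 (R : realType) (m n : nat) (n_ : 'I_m -> nat)
    (p : 'I_m -> rat) (s : nat)
    (hm : (0 < m)%N) (hn : (0 < n)%N) (hn_ : forall j, (0 < n_ j)%N)
    (hp : forall j, 0 < p j <= 1)
    (hsum : \sum_(j < m) p j * (n_ j)%:R / n%:R = 1)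
    (hs_pos : (0 < s)%N) (hs : forall j, p j * s%:R \is a Num.int)
    (Phi : mxtuple R n n_ -> R) :
  in_V p s Phi <->
  in_span (block_det (block_height hn hp hsum hs)) Phi.
Proof.
split; last exact: span_block_det_in_V.
exact: in_V_span_block_det.
Qed.
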